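(* Suppose the programming language is computably empty-frequent, and consider variant E of the halting problem. Then $$\forall T \in \textnormal{three-way(E)}: \exists c_T > 0: \exists n_T \in \mathbb{N}: \forall n \geq n_T: \frac{\overline d_T(n)}{p(n)} \geq c_T .$$ The same statement holds with generic(E) in place of three-way(E), but the analogous statement with approx(E) in place of three-way(E) is false.
   Context: Programs are strings over a finite alphabet $\Sigma$ ($|\Sigma|\ge2$) in a Turing-complete programming language in which programs can be effectively constructed, can refer to their own code, and can run other programs as subroutines or in parallel; each program on each input halts or runs forever; $p(n)$ is the number of programs of size (length) $n$. The language is computably empty-frequent if there is a decidable equivalence relation $\approx$ on programs such that (i) for each program $\pi$ there are $c_\pi>0$ and $n_\pi\in\mathbb{N}$ such that for every $n\ge n_\pi$ at least $c_\pi p(n)$ programs of size $n$ are equivalent to $\pi$, and (ii) if $\pi\approx\pi'$ then either both or neither of $\pi,\pi'$ halt on the empty input. Variant E: instances are programs; the question is whether the program halts on the empty input. A three-way tester always halts answering ``yes'', ``no'' or ``I don't know'', where ``yes''/``no'' must be correct; a generic-case tester on each instance either halts with a correct ``yes''/``no'' or fails to halt; an approximating tester always halts answering ``yes'' or ``no'', possibly incorrectly. three-way(E), generic(E), approx(E) denote the sets of such testers. An instance is hard for $T$ unless $T$ answers it correctly with ``yes'' or ``no''. $\overline d_T(n)$ is the number of hard non-halting instances of size $n$. *)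

(* Defs.v *)
From HB Require Import structures.
From mathcomp Require Import all_boot all_order all_algebra.
From mathcomp Require Import reals.

Set Implicit Arguments.
Unset Strict Implicit.
Unset Printing Implicit Defensive.

Import Order.TTheory GRing.Theory Num.Theory.

(** ** Partial recursive functions

  Arities are not tracked: a term is applied to a list of arguments, missing
  arguments read as 0 and extra ones are ignored.  Restricted to lists of
  length k, the terms define exactly the partial recursive functions of k
  variables. *)

Inductive recf : Type :=
| Zero
| Succ
| Proj of nat
| Comp of recf & seq recf
| Prec of recf & recf
| Mu of recf.

Fixpoint prec_graph (base : nat -> Prop) (step : nat -> nat -> nat -> Prop)
    (n y : nat) : Prop :=
  if n is m.+1 then exists2 z, prec_graph base step m z & step m z y
  else base y.

(* [eval f v y] : on arguments [v], [f] is defined with value [y].  Composition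
   is strict; [Mu f] is the least [y] with [f (y :: v) = 0], all the smaller
   arguments giving defined nonzero values. *)
Fixpoint eval (f : recf) (v : seq nat) (y : nat) {struct f} : Prop :=
  match f with
  | Zero => y = 0
  | Succ => y = (head 0 v).+1
  | Proj i => y = nth 0 v i
  | Comp g hs =>
      exists2 w : seq nat,
        (fix evals (hs : seq recf) (w : seq nat) {struct hs} : Prop :=
           match hs, w with
           | [::], [::] => True
           | h :: hs', x :: w' => eval h v x /\ evals hs' w'
           | _, _ => False
           end) hs w
        & eval g w y
  | Prec g h =>
      prec_graph (eval g (behead v))
        (fun m z => eval h [:: m, z & behead v]) (head 0 v) y
  | Mu g =>
      eval g (y :: v) 0 /\
      forall i, i < y -> exists2 z, eval g (i :: v) z & 0 < z
  end.

(** ** Computability on strings *)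

(* Bijective base-|Sigma| numeration, a bijection between strings and natural
   numbers as soon as Sigma is nonempty; the head of the list is the least
   significant digit. *)
Definition code (Sigma : finType) (w : seq Sigma) : nat :=
  foldr (fun a m => (m * #|Sigma| + enum_rank a).+1) 0 w.

(* [None] is the undefined value; nothing is required outside the domains. *)
Definition computable1 (Sigma : finType) (D : pred (seq Sigma))
    (F : seq Sigma -> option nat) : Prop :=
  exists f : recf, forall x, D x ->
    forall r, eval f [:: code x] r <-> F x = Some r.

Definition computable2 (Sigma : finType) (D E : pred (seq Sigma))
    (F : seq Sigma -> seq Sigma -> option nat) : Prop :=
  exists f : recf, forall x y, D x -> E y ->
    forall r, eval f [:: code x; code y] r <-> F x y = Some r.

(** ** Programming languages *)

(* [run pi x = None] means that [pi] runs forever on input [x];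
   [run pi x = Some y] that it halts with output [y].  The value of [run] on
   strings that are not programs is irrelevant. *)
Record language (Sigma : finType) := Language {
  prog : pred (seq Sigma);
  run : seq Sigma -> seq Sigma -> option (seq Sigma)
}.

(* The usual notion of an acceptable programming system: syntax is decidable,
   the language has a computable interpreter, and every computable family of
   partial computable functions is implemented by an effectively constructed
   family of programs.  Self-reference (Kleene's recursion theorem) and the
   ability to run programs as subroutines or in parallel follow from these. *)
Record turing_complete (Sigma : finType) (L : language Sigma) : Prop := {
  prog_decidable : computable1 predT (fun w => Some (nat_of_bool (prog L w)));
  run_computable :
    computable2 (prog L) predT (fun pi x => omap (@code Sigma) (run L pi x));
  run_complete : forall F : seq Sigma -> seq Sigma -> option (seq Sigma),
    computable2 predT predT (fun z x => omap (@code Sigma) (F z x)) ->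
    exists s : seq Sigma -> seq Sigma,
      computable1 predT (fun z => Some (code (s z))) /\
      forall z, prog L (s z) /\ forall x, run L (s z) x = F z x
}.

Definition halts (Sigma : finType) (L : language Sigma) (pi x : seq Sigma) :
  bool := isSome (run L pi x).

Definition halts_empty (Sigma : finType) (L : language Sigma)
  (pi : seq Sigma) : bool := halts L pi [::].

(* The number of programs of size n. *)
Definition nprog (Sigma : finType) (L : language Sigma) (n : nat) : nat :=
  #|[set w : n.-tuple Sigma | prog L w]|.

Definition computably_empty_frequent (R : realType) (Sigma : finType)
    (L : language Sigma) : Prop :=
  exists eqv : rel (seq Sigma),
    [/\ {in prog L & &, equivalence_rel eqv},
        computable2 (prog L) (prog L)
          (fun pi pi' => Some (nat_of_bool (eqv pi pi'))),
        forall pi, prog L pi ->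
          exists2 c : R, (0 < c)%R & exists n0 : nat, forall n, n0 <= n ->
            (c * (nprog L n)%:R
              <= #|[set w : n.-tuple Sigma | prog L w && eqv w pi]|%:R)%R
      & forall pi pi', prog L pi -> prog L pi' -> eqv pi pi' ->
          halts_empty L pi = halts_empty L pi'].

(** ** Testers for halting on the empty input *)

Inductive answer := Yes | No | DontKnow.

Definition answer_code (a : answer) : nat :=
  match a with No => 0 | Yes => 1 | DontKnow => 2 end.

(* A tester is represented by the partial function it computes; [None] means
   that it does not halt. *)
Definition tester (Sigma : finType) := seq Sigma -> option answer.

Definition tester_computable (Sigma : finType) (L : language Sigma)
    (T : tester Sigma) : Prop :=
  computable1 (prog L) (fun pi => omap answer_code (T pi)).

Definition sound (Sigma : finType) (L : language Sigma) (T : tester Sigma) :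
    Prop :=
  forall pi, prog L pi ->
    (T pi = Some Yes -> halts_empty L pi) /\
    (T pi = Some No -> ~~ halts_empty L pi).

Definition three_way (Sigma : finType) (L : language Sigma)
    (T : tester Sigma) : Prop :=
  [/\ tester_computable L T,
      forall pi, prog L pi -> T pi <> None
    & sound L T].

Definition generic (Sigma : finType) (L : language Sigma)
    (T : tester Sigma) : Prop :=
  [/\ tester_computable L T,
      forall pi, prog L pi -> T pi <> Some DontKnow
    & sound L T].

Definition approx (Sigma : finType) (L : language Sigma)
    (T : tester Sigma) : Prop :=
  tester_computable L T /\
  forall pi, prog L pi -> T pi = Some Yes \/ T pi = Some No.

Definition answers_correctly (Sigma : finType) (L : language Sigma)
    (T : tester Sigma) (pi : seq Sigma) : bool :=
  match T pi with
  | Some Yes => halts_empty L pi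
  | Some No => ~~ halts_empty L pi
  | _ => false
  end.

Definition hard (Sigma : finType) (L : language Sigma) (T : tester Sigma)
  (pi : seq Sigma) : bool := ~~ answers_correctly L T pi.

(* The number of hard non-halting instances of size n. *)
Definition dbar (Sigma : finType) (L : language Sigma) (T : tester Sigma)
    (n : nat) : nat :=
  #|[set w : n.-tuple Sigma |
      [&& prog L w, hard L T w & ~~ halts_empty L w]]|.

(* The ratio is meaningless at the sizes n for which there is no program, and
   nothing is claimed there; [turing_complete] makes the remaining sizes
   unbounded. *)
Definition hard_nonhalting_frequent (R : realType) (Sigma : finType)
    (L : language Sigma) (T : tester Sigma) : Prop :=
  exists2 c : R, (0 < c)%R & exists n0 : nat, forall n, n0 <= n ->
    0 < nprog L n -> (c <= (dbar L T n)%:R / (nprog L n)%:R)%R.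

(* Main.v *)
(** Given a tester T whose definite answers are correct, let P be a program that
  searches in parallel for a program w equivalent to P with T w = No, and halts
  if it finds one.  If P halted, then so would w, against the answer of T.
  Hence P runs forever and T answers No on no program equivalent to P: the whole
  class of P, which has positive frequency, consists of hard non-halting
  instances.  Self-reference comes from Kleene's recursion theorem, and the
  parallel search from the fact that, for each fixed term, evaluation with
  bounded fuel is a total recursive function.

  An approximating tester that always answers No is right on all non-halting
  instances, so it has no hard ones. *)

Require Import Defs.
From mathcomp Require Import all_boot all_order all_algebra.
From mathcomp Require Import reals.
From Stdlib Require List.
From mathcomp Require Import boolp zify.

Set Implicit Arguments.
Unset Strict Implicit.
Unset Printing Implicit Defensive.

Import Order.TTheory GRing.Theory Num.Theory.

(** * Composition and structural induction for terms *)

(** Names the fixpoint nested in [eval]; with [v] outside the [fix] the two are convertible. *)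
Definition evals (v : seq nat) :=
  fix evals (hs : seq recf) (w : seq nat) {struct hs} : Prop :=
    match hs, w with
    | [::], [::] => True
    | h :: hs', x :: w' => eval h v x /\ evals hs' w'
    | _, _ => False
    end.

Lemma eval_Comp g hs v y :
  eval (Comp g hs) v y = exists2 w, evals v hs w & eval g w y.
Proof. by []. Qed.

Lemma eval_Comp1 g h v y :
  eval (Comp g [:: h]) v y <-> exists2 x, eval h v x & eval g [:: x] y.
Proof.
split; first by case=> -[|x [|? ?]] [] // Hx _; exists x.
by case=> x Hx Hy; exists [:: x].
Qed.

Lemma eval_Comp2 g h1 h2 v y :
  eval (Comp g [:: h1; h2]) v y <->
  exists x1 x2, [/\ eval h1 v x1, eval h2 v x2 & eval g [:: x1; x2] y].
Proof.
split.
  by case=> -[|x1 [|x2 [|? ?]]] [] // H1 [] // H2 _; exists x1, x2.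
by case=> x1 [x2 [H1 H2 Hy]]; exists [:: x1; x2].
Qed.

Lemma eval_Comp3 g h1 h2 h3 v y :
  eval (Comp g [:: h1; h2; h3]) v y <->
  exists x1 x2 x3, [/\ eval h1 v x1, eval h2 v x2, eval h3 v x3
                     & eval g [:: x1; x2; x3] y].
Proof.
split.
  case=> -[|x1 [|x2 [|x3 [|? ?]]]] [] // H1 [] // H2 [] // H3 _ Hy.
  by exists x1, x2, x3.
by case=> x1 [x2 [x3 [H1 H2 H3 Hy]]]; exists [:: x1; x2; x3].
Qed.

(** Needed because the generated principle gives no hypothesis on the terms in the list of a
    [Comp]. *)
Lemma recf_nested_ind (P : recf -> Prop) :
  P Zero -> P Succ -> (forall i, P (Proj i)) ->
  (forall g hs, P g -> List.Forall P hs -> P (Comp g hs)) ->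
  (forall g h, P g -> P h -> P (Prec g h)) ->
  (forall g, P g -> P (Mu g)) -> forall f, P f.
Proof.
move=> P0 PS Pp PC PR PM; fix IH 1; case=> [||i|g hs|g h|g].
- exact: P0.
- exact: PS.
- exact: Pp.
- apply: PC; first exact: IH.
  by elim: hs => [|h hs IHhs]; constructor.
- by apply: PR; apply: IH.
- by apply: PM; apply: IH.
Qed.

(** * Evaluation with bounded fuel *)

(* The state is 0 while the search goes on, 1 once an undefined value has been
   met, and y + 2 once the least zero y has been found. *)
Definition mu_search (G : nat -> nat) (n : nat) : nat :=
  nat_rect (fun=> nat) 0
    (fun j s => if s is 0 then
                  match G j with 0 => 1 | 1 => j.+2 | _ => 0 end
                else s) n.

(* Evaluation with fuel k, which bounds every unbounded search: the result is
   0 if the fuel is insufficient, and y + 1 if the value is y. *)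
Fixpoint ev (f : recf) (k : nat) (v : seq nat) {struct f} : nat :=
  match f with
  | Zero => 1
  | Succ => (head 0 v).+2
  | Proj i => (nth 0 v i).+1
  | Comp g hs =>
      let ws := [seq ev h k v | h <- hs] in
      if all (leq 1) ws then ev g k [seq w.-1 | w <- ws] else 0
  | Prec g h =>
      nat_rect (fun=> nat) (ev g k (behead v))
        (fun m z => if z is z'.+1 then ev h k [:: m, z' & behead v] else 0)
        (head 0 v)
  | Mu g => (mu_search (fun j => ev g k (j :: v)) k).-1
  end.

(** [G] follows the convention of [ev]: 0 is undefined, 1 is the value zero, so [1 < G i] means
    defined and nonzero. *)
Lemma mu_search0 G n : mu_search G n = 0 <-> forall i, i < n -> 1 < G i.
Proof.
elim: n => [|n IH] /=; first by split.
split.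
- case E: (mu_search G n) => [|s] //.
  case EG: (G n) => [|[|g]] // _ i.
  rewrite ltnS leq_eqVlt => /orP[/eqP->|]; first by rewrite EG.
  by move: i; apply/IH.
- move=> H; have -> : mu_search G n = 0.
    by apply/IH => i Hi; apply: H; apply: ltnW.
  by have := H n (ltnSn n); case: (G n) => [|[|]].
Qed.

Lemma mu_search_found G n y :
  mu_search G n = y.+2 <->
  [/\ y < n, G y = 1 & forall i, i < y -> 1 < G i].
Proof.
elim: n => [|n IH] /=; first by split=> // -[].
split.
- case E: (mu_search G n) => [|s].
    case EG: (G n) => [|[|g]] // [<-]; split=> //.
    exact/mu_search0.
  move=> Es; have /IH[yn Gy Hy] : mu_search G n = y.+2 by rewrite E.
  by split=> //; apply: ltnW.
- case; rewrite ltnS leq_eqVlt => /orP[/eqP-> Gn Hn|yn Gy Hy].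
    by rewrite (proj2 (mu_search0 G n)) // Gn.
  by rewrite (proj2 IH).
Qed.

(** A nonzero result means that every search it relied on ended within the fuel. This lets finitely
    many fuels be merged into their maximum. *)
Lemma ev_mono f k k' v y : k <= k' -> ev f k v = y.+1 -> ev f k' v = y.+1.
Proof.
move=> kk'; elim/recf_nested_ind: f v y => //=.
- move=> g hs IHg IHhs v y; case: ifP => // Hall Eg.
  have Ehs : [seq ev h k' v | h <- hs] = [seq ev h k v | h <- hs].
    elim: IHhs Hall {Eg} => //= h hs' IHh _ IH /andP[Hh Hall].
    rewrite IH //; congr (_ :: _).
    by case E: (ev h k v) Hh => // _; apply: IHh.
  by rewrite Ehs Hall; apply: IHg.
- move=> g h IHg IHh v; elim: (head 0 v) => [|m IH] y /=; first exact: IHg.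
  case E: (nat_rect _ _ _ m) => [|z] // Eh.
  by rewrite (IH z E); apply: IHh.
- move=> g IHg v y E.
  have /mu_search_found[yk Ey Hy] :
      mu_search (fun j => ev g k (j :: v)) k = y.+2.
    by case: (mu_search _ _) E => // s /= ->.
  rewrite (proj2 (mu_search_found _ _ y)) //; split.
  + exact: leq_trans kk'.
  + exact: IHg.
  + move=> i /Hy; case E': (ev g k (i :: v)) => [|[|z]] // _.
    by rewrite (IHg _ _ E').
Qed.

Lemma ev_sound f k v y : ev f k v = y.+1 -> eval f v y.
Proof.
elim/recf_nested_ind: f v y => [||i|g hs IHg IHhs|g h IHg IHh|g IHg] v y.
- by case.
- by case.
- by case.
- rewrite eval_Comp /=; case: ifP => // Hall Eg.
  exists [seq w.-1 | w <- [seq ev h k v | h <- hs]]; last exact: IHg.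
  elim: IHhs Hall {Eg} => //= h hs' IHh _ IH /andP[Hh Hall].
  by split; [apply: IHh; rewrite prednK | apply: IH].
- rewrite /=; elim: (head 0 v) y => [|m IH] y /=; first exact: IHg.
  case E: (nat_rect _ _ _ m) => [|z] // Eh.
  by exists z; [apply: IH | apply: IHh].
- rewrite /= => E.
  have /mu_search_found[yk Ey Hy] :
      mu_search (fun j => ev g k (j :: v)) k = y.+2.
    by case: (mu_search _ _) E => // s /= ->.
  split; first exact: IHg.
  move=> i /Hy; case E': (ev g k (i :: v)) => [|[|z]] // _.
  by exists z.+1 => //; apply: IHg.
Qed.

(** A defined value depends on finitely many subcomputations; the maximum of their fuels suffices by
    [ev_mono]. *)
Lemma ev_complete f v y : eval f v y -> exists k, ev f k v = y.+1.
Proof.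
elim/recf_nested_ind: f v y => [||i|g hs IHg IHhs|g h IHg IHh|g IHg] v y.
- by move=> /= ->; exists 0.
- by move=> /= ->; exists 0.
- by move=> /= ->; exists 0.
- rewrite eval_Comp => -[w Hw /IHg[k Ek]].
  have [k' Ek'] : exists k', [seq ev h k' v | h <- hs] = [seq x.+1 | x <- w].
    elim: IHhs w Hw {Ek} => [|h hs' IHh _ IH] [|x w] //=.
    case=> Hx Hw.
    have [k1 E1] := IHh _ _ Hx; have [k2 E2] := IH _ Hw.
    exists (maxn k1 k2); rewrite (ev_mono (leq_maxl k1 k2) E1); congr (_ :: _).
    elim: hs' {IH Hw} w E2 => [|h' hs' IH] [|x' w'] //= [E2 E3].
    by rewrite (ev_mono (leq_maxr k1 k2) E2) (IH w').
  exists (maxn k k') => /=.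
  have -> : [seq ev h (maxn k k') v | h <- hs] = [seq x.+1 | x <- w].
    elim: hs {IHhs Hw Ek} w Ek' => [|h' hs' IH] [|x' w'] //= [E2 E3].
    by rewrite (ev_mono (leq_maxr k k') E2) (IH w').
  rewrite all_map (eq_all (a2 := predT)) // all_predT -map_comp map_id.
  exact: ev_mono (leq_maxl k k') Ek.
- rewrite /=; elim: (head 0 v) y => [|m IH] y /=; first exact: IHg.
  case=> z /IH[k1 E1] /IHh[k2 E2].
  exists (maxn k1 k2).
  have := @ev_mono (Prec g h) k1 (maxn k1 k2) (m :: behead v) z
            (leq_maxl _ _).
  rewrite /= => /(_ E1) ->.
  exact: ev_mono (leq_maxr k1 k2) E2.
- case=> /IHg[k0 E0] Hlt.
  have [k1 H1] : exists k, forall i, i < y -> 1 < ev g k (i :: v).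
    elim: y {E0} Hlt => [|y IH] Hlt; first by exists 0.
    have [k1 H1] : exists k, forall i, i < y -> 1 < ev g k (i :: v).
      by apply: IH => i Hi; apply: Hlt; apply: ltnW.
    have [z /IHg[k2 E2] z0] := Hlt y (ltnSn y).
    exists (maxn k1 k2) => i; rewrite ltnS leq_eqVlt => /orP[/eqP->|/H1].
      by rewrite (ev_mono (leq_maxr k1 k2) E2).
    case E: (ev g k1 (i :: v)) => [|t] // Ht.
    by rewrite (ev_mono (leq_maxl k1 k2) E).
  (* The fuel is also the range of the search, so it must exceed [y]. *)
  set k := maxn y.+1 (maxn k0 k1).
  have k0k : k0 <= k by rewrite /k; lia.
  have k1k : k1 <= k by rewrite /k; lia.
  exists k => /=; rewrite (proj2 (mu_search_found _ _ y)) //; split.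
  + by rewrite /k; lia.
  + exact: ev_mono k0k E0.
  + move=> i /H1; case E: (ev g k1 (i :: v)) => [|t] // Ht.
    by rewrite (ev_mono k1k E).
Qed.

(** * Closure properties of total recursive functions *)

(** The length is fixed because a term can pass on the tail of its argument list only as a fixed
    number of projections. *)
Definition total_rec (a : nat) (F : seq nat -> nat) : Prop :=
  exists f : recf, forall v, size v = a -> forall y, eval f v y <-> y = F v.

Lemma eq_total_rec a F G :
  (forall v, size v = a -> F v = G v) -> total_rec a F -> total_rec a G.
Proof. by move=> FG [f Hf]; exists f => v Hv y; rewrite -FG // Hf. Qed.

Lemma total_rec_nth a i : total_rec a (fun v => nth 0 v i).
Proof. by exists (Proj i). Qed.

Lemma total_rec_comp a (Hs : seq (seq nat -> nat)) G :
  total_rec (size Hs) G -> List.Forall (total_rec a) Hs ->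
  total_rec a (fun v => G [seq H v | H <- Hs]).
Proof.
case=> g Hg HHs.
have [hs Hhs] : exists hs, forall v, size v = a ->
    forall w, evals v hs w <-> w = [seq H v | H <- Hs].
  elim: HHs {Hg} => [|H Hs' [h Hh] _ [hs Hhs]].
    by exists [::] => v _ [|x w].
  exists (h :: hs) => v Hv [|x w] //=; split.
    by case=> /(Hh v Hv) -> /(Hhs v Hv) ->.
  by case=> /(Hh v Hv) ? /(Hhs v Hv).
exists (Comp g hs) => v Hv y; rewrite eval_Comp; split.
  by case=> w /(Hhs v Hv) ->; rewrite Hg // size_map.
move=> ->; exists [seq H v | H <- Hs]; first exact/Hhs.
by rewrite Hg // size_map.
Qed.

Lemma total_rec_prec a G H : total_rec a G -> total_rec a.+2 H ->
  total_rec a.+1 (fun v => nat_rect (fun=> nat) (G (behead v))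
                   (fun m z => H [:: m, z & behead v]) (head 0 v)).
Proof.
case=> g Hg [h Hh]; exists (Prec g h) => -[|n v] //= [Hv].
elim: n => [|n IH] y /=; first exact: Hg.
split; first by case=> z /IH -> /Hh -> //; rewrite /= Hv.
by move=> ->; eexists; [apply/IH | apply/Hh => //=; rewrite Hv].
Qed.

Lemma total_rec_const a c : total_rec a (fun=> c).
Proof.
elim: c => [|c IH]; first by exists Zero.
apply: (@total_rec_comp a [:: fun=> c] (fun v => (head 0 v).+1)).
  by exists Succ.
by constructor.
Qed.

Lemma total_rec_comp1 a G F : total_rec 1 (fun v => G (head 0 v)) ->
  total_rec a F -> total_rec a (fun v => G (F v)).
Proof. by move=> HG HF; apply: (total_rec_comp (Hs := [:: F]) HG); constructor. Qed.

Lemma total_rec_succ a F : total_rec a F -> total_rec a (fun v => (F v).+1).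
Proof. by apply: (total_rec_comp1 (G := succn)); exists Succ. Qed.

Lemma total_rec_pred a F : total_rec a F -> total_rec a (fun v => (F v).-1).
Proof.
apply: (total_rec_comp1 (G := predn)).
(* The predecessor is a recursion whose step returns its counter. *)
apply: eq_total_rec (total_rec_prec (total_rec_const 0 0) (total_rec_nth 2 0)).
by case=> [|[|n] []].
Qed.

(** A case distinction is a primitive recursion on the condition whose step ignores the previous
    value. *)
Lemma total_rec_if0 a C A B :
  total_rec a C -> total_rec a A -> total_rec a B ->
  total_rec a (fun v => if C v is 0 then A v else B v).
Proof.
move=> HC HA HB.
have T3 : total_rec 3
    (fun v => if nth 0 v 0 is 0 then nth 0 v 1 else nth 0 v 2).
  apply: eq_total_rec
    (total_rec_prec (total_rec_nth 2 0) (total_rec_nth 4 3)).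
  by move=> [|[|n] [|x [|y []]]].
by apply: (total_rec_comp (Hs := [:: C; A; B]) T3); do 3!constructor=> //.
Qed.

Definition projs (m a : nat) : seq (seq nat -> nat) :=
  [seq (fun v => nth 0 v i) | i <- iota m a].

Lemma size_projs m a : size (projs m a) = a.
Proof. by rewrite size_map size_iota. Qed.

Lemma total_rec_projs b m a : List.Forall (total_rec b) (projs m a).
Proof.
rewrite /projs; elim: a m => [|a IH] m /=; constructor=> //.
exact: total_rec_nth.
Qed.

Lemma map_projs m a v : size v = (m + a)%N ->
  [seq H v | H <- projs m a] = drop m v.
Proof.
move=> Hv; rewrite -map_comp; apply: (@eq_from_nth _ 0).
  by rewrite size_map size_iota size_drop Hv addKn.
move=> i; rewrite size_map size_iota => Hi.
by rewrite (nth_map 0) ?size_iota //= nth_iota // nth_drop.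
Qed.

(** Induction on the fixed term [f] avoids a universal machine. The arity stays general because
    subterms receive longer or shorter lists. *)
Lemma total_rec_ev f a :
  total_rec a.+1 (fun kv => ev f (head 0 kv) (behead kv)).
Proof.
elim/recf_nested_ind: f a => [||i|g hs IHg IHhs|g h IHg IHh|g IHg] a.
- exact: total_rec_const.
- do 2!apply: total_rec_succ.
  apply: eq_total_rec (total_rec_nth a.+1 1).
  by case=> [|? []].
- apply: total_rec_succ.
  by apply: eq_total_rec (total_rec_nth a.+1 i.+1); case.
- pose E h kv := ev h (head 0 kv) (behead kv).
  have Hall : total_rec a.+1
      (fun kv => nat_of_bool (all (leq 1) [seq E h kv | h <- hs])).
    elim: IHhs => [|h hs' IHh _ IH]; first exact: total_rec_const.
    apply: eq_total_rec
      (total_rec_if0 (IHh a) (total_rec_const _ 0) IH) => v _ /=.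
    by rewrite /E; case: (ev h _ _).
  have Hcomp : total_rec a.+1
      (fun kv => E g (head 0 kv :: [seq (E h kv).-1 | h <- hs])).
    pose Hs := (fun kv => nth 0 kv 0) :: [seq (fun kv => (E h kv).-1) | h <- hs].
    have := @total_rec_comp a.+1 Hs (E g).
    rewrite /= size_map => /(_ (IHg _)) H.
    apply: eq_total_rec (H _) => [v _|].
      by rewrite nth0 -map_comp.
    constructor; first exact: total_rec_nth.
    elim: IHhs {Hall Hs H} => [|h hs' IHh _ IH] /=; constructor=> //.
    exact/total_rec_pred/IHh.
  apply: eq_total_rec (total_rec_if0 Hall (total_rec_const _ 0) Hcomp).
  move=> v _ /=; rewrite /E.
  by case: (all _ _) => //; rewrite -map_comp.
(* Without arguments the counter reads as 0 and only the base is evaluated. *)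
- case: a => [|a].
    apply: eq_total_rec (IHg 0); by case=> [|k []].
  (* Prec recurses on its first argument, so fuel and counter are swapped. *)
  pose H v := if nth 0 v 1 is 0 then 0 else
    ev h (nth 0 v 2) [:: nth 0 v 0, (nth 0 v 1).-1 & drop 3 v].
  have HH : total_rec a.+3 H.
    apply: total_rec_if0; [exact: total_rec_nth|exact: total_rec_const|].
    pose Hs := [:: (fun v => nth 0 v 2), (fun v => nth 0 v 0),
                   (fun v => (nth 0 v 1).-1) & projs 3 a].
    have := @total_rec_comp a.+3 Hs (fun kv => ev h (head 0 kv) (behead kv)).
    rewrite /= size_projs => /(_ (IHh _)) HT.
    apply: eq_total_rec (HT _) => [v Hv|]; first by rewrite map_projs.
    do 2!(constructor; first exact: total_rec_nth).
    constructor; first exact/total_rec_pred/total_rec_nth.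
    exact: total_rec_projs.
  have := total_rec_prec (IHg a) HH.
  pose Hs := [:: (fun v => nth 0 v 1), (fun v => nth 0 v 0) & projs 2 a].
  move=> HP; have := @total_rec_comp a.+2 Hs _.
  rewrite /= size_projs => /(_ _ HP) HT.
  apply: eq_total_rec (HT _) => [v Hv|].
    rewrite map_projs // /H {HT HP HH H Hs}.
    case: v Hv => [|k [|n v]] //= _; rewrite drop0.
    by elim: n => //= n ->; rewrite drop0; case: (nat_rect _ _ _ _).
  do 2!(constructor; first exact: total_rec_nth).
  exact: total_rec_projs.
- apply: total_rec_pred.
  (* The arguments are the candidate, the search state, the fuel, then the original arguments. *)
  pose E v := ev g (nth 0 v 2) (nth 0 v 0 :: drop 3 v).
  have HE : total_rec a.+3 E.
    pose Hs := [:: (fun v => nth 0 v 2), (fun v => nth 0 v 0) & projs 3 a].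
    have := @total_rec_comp a.+3 Hs (fun kv => ev g (head 0 kv) (behead kv)).
    rewrite /= size_projs => /(_ (IHg _)) HT.
    apply: eq_total_rec (HT _) => [v Hv|]; first by rewrite map_projs.
    do 2!(constructor; first exact: total_rec_nth).
    exact: total_rec_projs.
  pose H v := if nth 0 v 1 is 0 then
                if E v is 0 then 1 else
                if (E v).-1 is 0 then (nth 0 v 0).+2 else 0
              else nth 0 v 1.
  have HH : total_rec a.+3 H.
    apply: total_rec_if0; [exact: total_rec_nth| |exact: total_rec_nth].
    apply: total_rec_if0 => //; first exact: total_rec_const.
    apply: total_rec_if0; [exact: total_rec_pred| |exact: total_rec_const].
    by do 2!apply: total_rec_succ; exact: total_rec_nth.
  have HP := total_rec_prec (total_rec_const a.+1 0) HH.
  (* The fuel is duplicated: once as the length of the search, once as the fuel of each test. *)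
  pose Hs := [:: (fun v => nth 0 v 0), (fun v => nth 0 v 0) & projs 1 a].
  have := @total_rec_comp a.+1 Hs _.
  rewrite /= size_projs => /(_ _ HP) HT.
  apply: eq_total_rec (HT _) => [v Hv|].
    rewrite map_projs // /H /E {HT HP HH HE H E Hs}.
    case: v Hv => [|k v] //= _; rewrite drop0.
    suff H n : nat_rect (fun=> nat) 0 (fun m z =>
        if z is 0 then
          if ev g k (m :: drop 0 v) is 0 then 1 else
          if (ev g k (m :: drop 0 v)).-1 is 0 then m.+2 else 0
        else z) n = mu_search (fun j => ev g k (j :: v)) n by exact: H.
    elim: n => //= n ->; rewrite drop0; case: (mu_search _ _) => //.
    by case: (ev g _ _) => [|[|]].
  do 2!(constructor; first exact: total_rec_nth).
  exact: total_rec_projs.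
Qed.

(** * Parallel search for a zero of a partial function *)

(** A direct [Mu] would get stuck where [B] is undefined. Minimisation is applied instead to a total
    test: whether [B] vanishes at some [m < y] with fuel [y]. *)
Lemma recf_dovetail (B : recf) : exists S : recf, forall z x r,
  eval S [:: z; x] r <-> r = 0 /\ exists m, eval B [:: m; z] 0.
Proof.
(* Qn n k z = 0 iff B takes the value 0 with fuel k at some m < n. *)
pose Qn n k z := nat_rect (fun=> nat) 1
  (fun m s => if ev B k [:: m; z] is 0 then s else
              if (ev B k [:: m; z]).-1 is 0 then 0 else s) n.
have Qn0 n k z : Qn n k z = 0 <-> exists2 m, m < n & ev B k [:: m; z] = 1.
  elim: n => [|n IH] /=; first by split=> // -[].
  split.
    case E: (ev B k [:: n; z]) => [|[|e]] /= Q.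
    - by have /IH[m mn Em] := Q; exists m => //; apply: ltnW.
    - by exists n.
    - by have /IH[m mn Em] := Q; exists m => //; apply: ltnW.
  case=> m; rewrite ltnS leq_eqVlt => /orP[/eqP-> -> //|mn Em].
  have Q0 : Qn n k z = 0 by apply/IH; exists m.
  by case: (ev B k [:: n; z]) => [|[|e]] //=.
have [q Hq] : total_rec 3 (fun v => Qn (nth 0 v 0) (nth 0 v 0) (nth 0 v 1)).
  have HE : total_rec 4 (fun v => ev B (nth 0 v 2) [:: nth 0 v 0; nth 0 v 3]).
    apply: (@total_rec_comp 4 [:: (fun v => nth 0 v 2); (fun v => nth 0 v 0);
      (fun v => nth 0 v 3)] _ (total_rec_ev B 2)).
    by do 3!(constructor; first exact: total_rec_nth).
  have H1 := total_rec_nth 4 1.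
  have HP := total_rec_prec (total_rec_const 2 1) (total_rec_if0 HE H1
    (total_rec_if0 (total_rec_pred HE) (total_rec_const _ 0) H1)).
  apply: (@total_rec_comp 3 [:: (fun v => nth 0 v 0); (fun v => nth 0 v 0);
      (fun v => nth 0 v 1)] _ HP).
  by do 3!(constructor; first exact: total_rec_nth).
(* [Zero] discards the bound found and outputs 0, the code of the empty string. *)
exists (Comp Zero [:: Mu q]) => z x r; rewrite eval_Comp1; split.
  case=> y [/Hq-/(_ erefl) /= Q _] /= ->; split=> //.
  have /Qn0[m _ Em] := esym Q.
  by exists m; apply: ev_sound Em.
case=> -> [m /ev_complete[k Ek]].
have : exists k, Qn k k z == 0.
  exists (maxn m.+1 k); apply/eqP/Qn0; exists m; first exact: leq_maxl.
  exact: ev_mono (leq_maxr _ _) Ek.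
case/ex_minnP=> y /eqP Qy ymin.
exists y => //; split; first by apply/Hq.
move=> i iy; exists (Qn i i z); first exact/Hq.
by rewrite lt0n; apply/negP => /ymin; rewrite leqNgt iy.
Qed.

(** * Programs, self-reference and the hard class *)

(** Quotient and remainder of [n] by the alphabet size give the tail and first digit for [n.+1].
    Hence a search over numbers reaches every string. *)
Lemma code_surj (Sigma : finType) : 0 < #|Sigma| ->
  forall n, exists w : seq Sigma, code w = n.
Proof.
move=> S0; elim/ltn_ind => -[|n] IH; first by exists [::].
have [w Hw] := IH (n %/ #|Sigma|) (leq_ltn_trans (leq_div _ _) (ltnSn n)).
exists (enum_val (Ordinal (ltn_pmod n S0)) :: w).
rewrite /code /= -/(code w) Hw enum_valK /=.
by rewrite -divn_eq.
Qed.

Section Language.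

Variables (Sigma : finType) (L : language Sigma).
Hypotheses (Sigma_gt0 : 0 < #|Sigma|) (L_complete : turing_complete L).

(** Programs with distinct constant outputs are distinct, hence infinitely many, while only finitely
    many strings are shorter than [n0]. *)
Lemma prog_size_unbounded n0 : exists2 n, n0 <= n & 0 < nprog L n.
Proof.
have [|s [_ Hs]] := run_complete L_complete (F := fun z _ => Some z).
  by exists (Proj 0) => x y _ _ r /=; split=> [->|[->]].
have s_inj : injective s.
  move=> z z' E; have [_ /(_ [::])] := Hs z; have [_ /(_ [::])] := Hs z'.
  by rewrite E => -> [].
have /card_gt0P[a _] := Sigma_gt0.
pose short := flatten
  [seq [seq val t | t <- enum {: n.-tuple Sigma}] | n <- iota 0 n0].
have short_mem w : size w < n0 -> w \in short.
  move=> Hw; apply/flattenP; exists [seq val t | t <- enum {: (size w).-tuple Sigma}].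
    by apply/mapP; exists (size w) => //; rewrite mem_iota.
  by apply/mapP; exists (in_tuple w); rewrite ?mem_enum.
pose ps := [seq s (nseq i a) | i <- iota 0 (size short).+1].
have ps_uniq : uniq ps.
  rewrite map_inj_uniq ?iota_uniq // => i j /s_inj E.
  by rewrite -(size_nseq i a) E size_nseq.
have : ~~ all (fun w => size w < n0) ps.
  apply/negP => /allP H.
  have := uniq_leq_size ps_uniq (fun w wps => short_mem w (H w wps)).
  by rewrite size_map size_iota ltnn.
case/allPn => w /mapP[i _ ->]; rewrite -leqNgt => Hi.
exists (size (s (nseq i a))) => //; apply/card_gt0P.
by exists (in_tuple (s (nseq i a))); rewrite inE; case: (Hs (nseq i a)).
Qed.

(* Kleene's recursion theorem: if e is a program for s, the program s e computes
   its own code by running e on e. *)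
Lemma self_referential_search (B : recf) : exists e P : seq Sigma,
  [/\ prog L e, prog L P, run L e e = Some P &
      halts_empty L P <-> exists m, eval B [:: m; code e] 0].
Proof.
have [S HS] := recf_dovetail B.
(* The undecidable condition only specifies a partial function; [S] computes it by halting exactly
   when the condition holds. *)
have [|s [[fs Hfs] Hs]] := run_complete L_complete (F := fun z _ =>
  if `[< exists m, eval B [:: m; code z] 0 >] then Some [::] else None).
  exists S => z x _ _ r; rewrite HS.
  case: asboolP => H /=; last by split=> // -[].
  by split=> [[->]|[<-]].
(* This family is constant in its parameter: each member computes [s], so any of them can serve as
   [e]. *)
have [|s' [_ Hs']] := run_complete L_complete (F := fun _ x => Some (s x)).
  exists (Comp fs [:: Proj 1]) => z x _ _ r; rewrite eval_Comp1.
  split; first by case=> _ /= -> /Hfs-/(_ erefl).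
  by move=> /= Er; exists (code x) => //; apply/Hfs.
have [prog_e run_e] := Hs' [::].
exists (s' [::]), (s (s' [::])); have [prog_P run_P] := Hs (s' [::]).
split=> //; rewrite /halts_empty /halts run_P.
by case: asboolP.
Qed.

(** Stated for computable sound testers, which covers three-way and generic ones at once. *)
Lemma exists_hard_class (T : tester Sigma) (eqv : rel (seq Sigma)) :
  computable2 (prog L) (prog L)
    (fun pi pi' => Some (nat_of_bool (eqv pi pi'))) ->
  (forall pi pi', prog L pi -> prog L pi' -> eqv pi pi' ->
     halts_empty L pi = halts_empty L pi') ->
  tester_computable L T -> sound L T ->
  exists2 P, prog L P & forall w, prog L w -> eqv w P ->
    hard L T w /\ ~~ halts_empty L w.
Proof.
move=> [te Hte] eqv_halts [tT HT] T_sound.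
have [tp Hp] := prog_decidable L_complete.
have [tr Hr] := run_computable L_complete.
(* The result is 0 only if both flags are nonzero and the third entry is 0, the code of [No]. On a
   non-program the first flag is 0, so arbitrary values of [te] and [tT] there do no harm. *)
have [c Hc] : total_rec 3 (fun v =>
    if nth 0 v 0 is 0 then 1 else if nth 0 v 1 is 0 then 1 else nth 0 v 2).
  by do 2!(apply: total_rec_if0;
    [exact: total_rec_nth | exact: total_rec_const | ]); exact: total_rec_nth.
(* [Comp tr [:: Proj 1; Proj 1]] runs [e] on itself, which recovers the code of [P]. *)
pose B := Comp c [:: Comp tp [:: Proj 0];
  Comp te [:: Proj 0; Comp tr [:: Proj 1; Proj 1]]; Comp tT [:: Proj 0]].
have [e [P [prog_e prog_P run_e halts_P]]] := self_referential_search B.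
have BP w : eval B [:: code w; code e] 0 <->
    [/\ prog L w, eqv w P & T w = Some No].
  rewrite eval_Comp3; split.
    case=> a [b [d [Ha Hb Hd]]].
    case/eval_Comp1: Ha => _ -> Ha; case/eval_Comp1: Hd => _ -> Hd.
    have [<-] := proj1 (Hp w erefl a) Ha.
    case/eval_Comp2: Hb => _ [r [-> Hb1 Hb]].
    case/eval_Comp2: Hb1 Hb => _ [_ [-> ->]].
    move=> /Hr-/(_ prog_e erefl); rewrite run_e => -[<-] Hb.
    move=> /Hc-/(_ erefl) /=; case prog_w: (prog L w) => //=.
    have [<-] := proj1 (Hte w P prog_w prog_P b) Hb.
    case: (eqv w P) => //= d0; rewrite -d0 in Hd; split=> //.
    have := proj1 (HT w prog_w 0) Hd.
    by case: (T w) => [[]|].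
  case=> prog_w w_P Tw; exists 1, 1, 0; split; last by apply/Hc.
  - apply/eval_Comp1; exists (code w) => //.
    by apply/Hp => //; rewrite prog_w.
  - apply/eval_Comp2; exists (code w), (code P); split=> //.
      apply/eval_Comp2; exists (code e), (code e); split=> //.
      by apply/Hr => //; rewrite run_e.
    by apply/Hte => //; rewrite w_P.
  - apply/eval_Comp1; exists (code w) => //.
    by apply/HT => //; rewrite Tw.
have P_loops : ~~ halts_empty L P.
  apply/negP => hP; have /halts_P[m Hm] := hP.
  have [w Ew] := code_surj Sigma_gt0 m; rewrite -Ew in Hm.
  have [prog_w w_P Tw] := proj1 (BP w) Hm.
  have [_ /(_ Tw)] := T_sound w prog_w.
  by rewrite (eqv_halts w P) // hP.
exists P => // w prog_w w_P.
have w_loops : ~~ halts_empty L w by rewrite (eqv_halts w P).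
split=> //; apply/negP; rewrite /answers_correctly.
case Tw: (T w) => [[]|] // _; first by have [/(_ Tw)] := T_sound w prog_w;
  rewrite (negPf w_loops).
by move/negP: P_loops; apply; apply/halts_P; exists (code w); apply/BP.
Qed.

End Language.

(** * Frequency bounds for the three kinds of tester *)

(** The constants are those of the class of [P], which lies inside the set counted by [dbar]. *)
Lemma sound_hard_nonhalting_frequent (R : realType) (Sigma : finType)
    (L : language Sigma) (T : tester Sigma) :
  0 < #|Sigma| -> turing_complete L -> computably_empty_frequent R L ->
  tester_computable L T -> sound L T -> hard_nonhalting_frequent R L T.
Proof.
move=> S0 Lc [eqv [_ eqv_comp eqv_freq eqv_halts]] Tc Ts.
have [P prog_P HP] := exists_hard_class S0 Lc eqv_comp eqv_halts Tc Ts.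
have [c c0 [n0 Hn0]] := eqv_freq P prog_P.
exists c => //; exists n0 => n /Hn0 Hn pn.
rewrite ler_pdivlMr ?ltr0n //; apply: le_trans Hn _.
rewrite ler_nat; apply: subset_leq_card; apply/subsetP => w.
by rewrite !inE => /andP[pw wP]; have [-> ->] := HP w pw wP; rewrite pw.
Qed.

Theorem theorem3 (R : realType) (Sigma : finType) (L : language Sigma)
  (Sigma_ge2 : 2 <= #|Sigma|)
  (L_complete : turing_complete L)
  (L_frequent : computably_empty_frequent R L) :
  [/\ forall T : tester Sigma, three_way L T ->
        hard_nonhalting_frequent R L T,
      forall T : tester Sigma, generic L T ->
        hard_nonhalting_frequent R L T
    & ~ (forall T : tester Sigma, approx L T ->
        hard_nonhalting_frequent R L T)].
Proof.
have S0 : 0 < #|Sigma| by exact: ltnW.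
split=> [T [Tc _ Ts]|T [Tc _ Ts]|H].
- exact: sound_hard_nonhalting_frequent.
- exact: sound_hard_nonhalting_frequent.
- have [|c c0 [n0 Hn0]] := H (fun=> Some No).
    split; last by right.
    by exists Zero => x _ r /=; split=> [->|[<-]].
  (* The bound is asserted only at sizes having programs, so a contradiction needs such a size
     beyond [n0]. *)
  have [n n0n pn] := prog_size_unbounded S0 L_complete n0.
  have := Hn0 n n0n pn.
  have -> : dbar L (fun=> Some No) n = 0.
    apply/eqP; rewrite cards_eq0; apply/eqP/setP => w.
    rewrite !inE /hard /answers_correctly negbK.
    by case: (halts_empty L w); rewrite ?andbF.
  by rewrite mul0r leNgt c0.
Qed.
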